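(* Let $G$ be a finite connected loopless undirected multigraph of genus $g=|E(G)|-|V(G)|+1$, and let $D$ be a divisor on $G$ with $\deg(D)=k\le g-1$. Then there exists a divisor $D'$ on $G$ such that $D\le D'$, $\deg(D')=g-1$, and $r(D)=r(D')$.
   Context: A divisor on $G$ is a function $D:V(G)\to\mathbb{Z}$; $\deg(D)=\sum_vD(v)$; $D_1\le D_2$ means $D_1(v)\le D_2(v)$ for all $v$; $D$ is effective if $D\ge0$. Two divisors are linearly equivalent if their difference lies in the $\mathbb{Z}$-span of the columns of the Laplacian matrix of $G$. The (Baker--Norine) rank $r(D)$ is $\min\deg(E)-1$ over all effective $E$ such that $D-E$ is not linearly equivalent to any effective divisor. *)

(* Defs.v *)
From HB Require Import structures.
From mathcomp Require Import all_boot all_order all_algebra.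
From mathcomp Require Import boolp.
Set Implicit Arguments.
Unset Strict Implicit.
Unset Printing Implicit Defensive.
Import Order.TTheory GRing.Theory Num.Theory.
Local Open Scope ring_scope.

(* Parallel edges are distinct elements of [edge] with the same pair of ends;
   an edge has exactly two distinct ends, so there are no loops. *)
Record multigraph := Multigraph {
  vert : finType;
  edge : finType;
  ends : edge -> {set vert};
  card_ends : forall e : edge, #|ends e| = 2;
  card_vert_gt0 : (0 < #|vert|)%N }.

Section MultigraphDefs.
Variable G : multigraph.
Implicit Types (u v : vert G) (e : edge G).

Definition adjacent : rel (vert G) :=
  [rel u v | [exists e : edge G, ends e == [set u; v]]].

Definition mg_connected : Prop := forall u v, connect adjacent u v.

Definition genus : int := #|edge G|%:Z - #|vert G|%:Z + 1.

Definition valency v : nat := #|[set e : edge G | v \in ends e]|.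

Definition multiplicity u v : nat := #|[set e : edge G | ends e == [set u; v]]|.

Definition laplacian u v : int :=
  if u == v then (valency v)%:Z else - (multiplicity u v)%:Z.

Definition divisor := {ffun vert G -> int}.

Implicit Types D E : divisor.

Definition divdeg D : int := \sum_v D v.

Definition divle D1 D2 : Prop := forall v, D1 v <= D2 v.

Definition effective D : Prop := divle 0 D.

Definition laplacian_col v : divisor := [ffun u => laplacian u v].

Definition lin_equiv D1 D2 : Prop :=
  exists c : vert G -> int, D1 - D2 = \sum_v laplacian_col v *~ c v.

Definition equiv_effective D : Prop :=
  exists F : divisor, effective F /\ lin_equiv D F.

(* The degrees of the effective divisors over which the minimum defining the
   rank is taken; such degrees are nonnegative, hence natural numbers. *)
Definition rank_degree D : pred nat := fun n =>
  `[< exists E : divisor,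
        [/\ effective E, divdeg E = n%:Z & ~ equiv_effective (D - E)] >].

Lemma divdegB D E : divdeg (D - E) = divdeg D - divdeg E.
Proof. by rewrite /divdeg -sumrB; apply: eq_bigr => v _; rewrite !ffunE. Qed.

Lemma divdeg_effective D : effective D -> 0 <= divdeg D.
Proof. by move=> D0; apply: sumr_ge0 => v _; have := D0 v; rewrite ffunE. Qed.

Lemma valencyE v : valency v = (\sum_(u | u != v) multiplicity u v)%N.
Proof.
rewrite /valency -sum1_card.
under [RHS]eq_bigr => u _ do rewrite /multiplicity -sum1_card big_mkcond /=.
rewrite exchange_big /= big_mkcond; apply: eq_bigr => e _.
rewrite inE; under eq_bigr => u _ do rewrite inE.
rewrite -big_mkcondr sum1_card.
have /eqP/cards2P[x [y [nxy exy]]] := card_ends e; rewrite exy.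
case: ifPn => [|vN]; last first.
  apply/esym/eq_card0 => u; rewrite inE; apply/negbTE/negP => /andP[_ /eqP E].
  by move: vN; rewrite E !inE eqxx orbT.
have key a b : a != b ->
    #|[pred u | (u != b) && ([set a; b] == [set u; b])]| = 1%N.
  move=> nab; rewrite -(card1 a); apply: eq_card => u; rewrite !inE.
  apply/andP/eqP => [[ub /eqP/setP/(_ u)]|->]; last by rewrite nab eqxx.
  by rewrite !inE eqxx (negPf ub) orbF /= => /eqP.
by rewrite !inE => /orP[]/eqP->; [rewrite setUC key 1?eq_sym|rewrite key].
Qed.

Lemma divdeg_laplacian_col v : divdeg (laplacian_col v) = 0.
Proof.
rewrite /divdeg (bigD1 v) //= ffunE /laplacian eqxx valencyE.
rewrite (eq_bigr (fun u => - (multiplicity u v)%:Z)); last first.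
  by move=> u uv; rewrite ffunE /laplacian (negPf uv).
by rewrite sumrN -(big_morph Posz PoszD (erefl _)) subrr.
Qed.

Lemma lin_equiv_divdeg D E : lin_equiv D E -> divdeg D = divdeg E.
Proof.
move=> [c /(congr1 divdeg)]; rewrite divdegB => Ec; apply/eqP.
rewrite -subr_eq0 Ec /divdeg.
under eq_bigr => u _ do rewrite sum_ffunE.
rewrite exchange_big big1 //= => v _.
have := divdeg_laplacian_col v; rewrite /divdeg => l0.
under eq_bigr => u _ do rewrite ffunMzE.
by rewrite -mulrz_suml l0 mul0rz.
Qed.

Lemma rank_degree_exists D : exists n, rank_degree D n.
Proof.
have /card_gt0P[v0 _] := card_vert_gt0 G.
pose n := `|divdeg D|%N.+1.
pose E : divisor := [ffun v => if v == v0 then n%:Z else 0].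
have Edeg : divdeg E = n%:Z.
  rewrite /divdeg; under eq_bigr => v _ do rewrite ffunE.
  by rewrite -big_mkcond big_pred1_eq.
exists n; apply/asboolP; exists E; split => //.
  by move=> v; rewrite !ffunE; case: ifP.
move=> [F [/divdeg_effective F0 /lin_equiv_divdeg]].
rewrite divdegB Edeg => DF; move: F0; rewrite -DF subr_ge0 leNgt.
by rewrite /n -addn1 PoszD abszE ltzD1 ler_norm.
Qed.

Definition rank D : int := (ex_minn (rank_degree_exists D))%:Z - 1.

End MultigraphDefs.

(* Main.v *)
(* If [E] is an effective divisor of least degree such that [D - E] is not
   equivalent to an effective divisor, then [D - E] lies below some [F] of degree
   [g - 1] which is not equivalent to an effective divisor either. As
   [deg (F - (D - E)) >= g - 1 - k], one can choose [0 <= H <= F - (D - E)] of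
   degree [g - 1 - k]; then [D' = D + H] satisfies [D' - E <= F], so [E] also
   bounds the rank of [D'] from above, while the rank is monotone.

   The divisor [F] comes from chip firing. In the class of [D - E], a divisor of
   minimal debt stays in debt at some vertex [q] under legal firings; firing as
   often as possible leads to a divisor from which no set can be fired, and
   Dhar's burning order of the vertices then yields an acyclic-orientation
   divisor above it. *)
Require Import Defs.
From HB Require Import structures.
From mathcomp Require Import all_boot all_order all_algebra.
From mathcomp Require Import boolp zify.
Set Implicit Arguments.
Unset Strict Implicit.
Unset Printing Implicit Defensive.
Import Order.TTheory GRing.Theory Num.Theory.
Local Open Scope ring_scope.

Lemma exists_argmin_nat (T : Type) (P : T -> Prop) (m : T -> nat) :
  (exists x, P x) -> exists2 x, P x & forall y, P y -> (m x <= m y)%N.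
Proof.
move=> [x0 Px0].
have ex : exists n, `[< exists2 x, P x & m x = n >].
  by exists (m x0); apply/asboolP; exists x0.
case: (ex_minnP ex) => n /asboolP[x Px <-] minx.
by exists x => // y Py; apply: minx; apply/asboolP; exists y.
Qed.

(** * The Laplacian as an operator on firing vectors *)

Section Laplacian.
Variable G : multigraph.
Implicit Types (u v w : vert G) (A U W : {set vert G}) (D E F : divisor G).
Implicit Types (f g : vert G -> int).

(* [ffunE] rewrites to terms whose codomain [lia] does not recognise as [int]. *)
Lemma divisorBE D E v : (D - E) v = D v - E v.
Proof. by rewrite !ffunE. Qed.

Lemma divisorDE D E v : (D + E) v = D v + E v.
Proof. by rewrite ffunE. Qed.

Lemma divisor0E v : (0 : divisor G) v = 0.
Proof. by rewrite ffunE. Qed.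

Definition divisorE := (divisorBE, divisorDE, divisor0E).

Lemma multiplicityC u v : multiplicity u v = multiplicity v u.
Proof. by rewrite /multiplicity setUC. Qed.

Lemma multiplicity_diag v : multiplicity v v = 0%N.
Proof.
apply: eq_card0 => e; rewrite inE; apply/negbTE/eqP => ev.
by have := card_ends e; rewrite ev setUid cards1.
Qed.

Lemma valency_sum v : valency v = (\sum_u multiplicity v u)%N.
Proof.
rewrite valencyE [RHS](bigD1 v) //= multiplicity_diag add0n.
by apply: eq_bigr => u _; rewrite multiplicityC.
Qed.

Lemma adjacent_multiplicity u v : adjacent u v -> (0 < multiplicity u v)%N.
Proof. by case/existsP=> e uv; apply/card_gt0P; exists e; rewrite inE. Qed.

Lemma sum_multiplicity :
  (\sum_(v : vert G) \sum_u multiplicity v u = 2 * #|edge G|)%N.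
Proof.
under eq_bigr => v _ do rewrite -valency_sum /valency -sum1_card big_mkcond.
rewrite exchange_big /= mulnC -sum_nat_const; apply: eq_bigr => e _.
apply: etrans (card_ends e).
by rewrite -sum1_card [RHS]big_mkcond; apply: eq_bigr => v _; rewrite inE.
Qed.

(** [D - laplace f] is what remains of [D] after every [v] has fired [f v] times. *)
Definition laplace f : divisor G := \sum_v laplacian_col v *~ f v.

Lemma laplaceE f u : laplace f u = \sum_v (multiplicity u v)%:Z * (f u - f v).
Proof.
rewrite /laplace sum_ffunE.
under eq_bigr => v _ do rewrite ffunMzE ffunE.
under [RHS]eq_bigr => v _ do rewrite mulrBr.
rewrite sumrB -mulr_suml -(big_morph Posz PoszD (erefl _)) -valency_sum.
rewrite (bigD1 u) //= [in RHS](bigD1 u) //= multiplicity_diag mul0r add0r.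
rewrite /laplacian eqxx mulrzz; congr (_ + _); rewrite -sumrN.
by apply: eq_bigr => v; rewrite eq_sym => /negPf->; rewrite mulrzz mulNr.
Qed.

Lemma laplaceD f g : laplace (fun v => f v + g v) = laplace f + laplace g.
Proof.
by rewrite /laplace -big_split; apply: eq_bigr => v _; rewrite mulrzDr.
Qed.

Lemma laplace0 : laplace (fun=> 0) = 0.
Proof. by apply: big1 => v _; rewrite mulr0z. Qed.

Lemma divdeg_laplace f : divdeg (laplace f) = 0.
Proof.
have /lin_equiv_divdeg-> : lin_equiv (laplace f) 0 by exists f; rewrite subr0.
by apply: big1 => v _; rewrite ffunE.
Qed.

Lemma equiv_effectiveP D :
  equiv_effective D <-> exists f, effective (D - laplace f).
Proof.
split=> [[F [F0 [f DF]]]|[f eff]].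
  by exists f; rewrite /laplace -DF subKr.
by exists (D - laplace f); split=> //; exists f; rewrite subKr.
Qed.

Lemma equiv_effective_le D E :
  divle D E -> equiv_effective D -> equiv_effective E.
Proof.
move=> DE /equiv_effectiveP[f eff]; apply/equiv_effectiveP; exists f => v.
by have := eff v; have := DE v; rewrite !divisorE; lia.
Qed.

Lemma equiv_effective_laplace D f :
  equiv_effective (D - laplace f) <-> equiv_effective D.
Proof.
rewrite !equiv_effectiveP; split=> -[g eff].
  by exists (fun v => f v + g v); rewrite laplaceD opprD addrA.
exists (fun v => g v - f v); rewrite -addrA -opprD -laplaceD.
by under [fun v => _ + _]funext => v do rewrite addrC subrK.
Qed.

(** * Firing sets of vertices, and Dhar's burning order *)

Definition cut A v : nat := (\sum_(u | u \notin A) multiplicity v u)%N.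

Definition indicator A v : int := (v \in A)%:Z.

Lemma laplace_indicator_in A v : v \in A -> laplace (indicator A) v = (cut A v)%:Z.
Proof.
move=> vA; rewrite laplaceE /cut (big_morph Posz PoszD (erefl _)) [RHS]big_mkcond /=.
by apply: eq_bigr => u _; rewrite /indicator vA; case: (u \in A); rewrite ?mulr0 ?mulr1.
Qed.

Lemma laplace_indicator_notin A v :
  v \notin A -> laplace (indicator A) v <= 0.
Proof.
move=> vA; rewrite laplaceE; apply: sumr_le0 => u _.
by rewrite /indicator (negPf vA) sub0r mulrN oppr_le0.
Qed.

(* No nonempty set can be fired without leaving one of its members in debt;
   for the whole vertex set this says that [D] is not effective. *)
Definition unfireable D : Prop :=
  forall A, A != set0 -> exists2 v, v \in A & D v < (cut A v)%:Z.

(** If [D - laplace f] were effective, take the set where [f] is maximal: each of its vertices loses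
    at least one chip along every edge leaving the set, so the set could be fired from [D]. *)
Lemma unfireable_not_equiv_effective D : unfireable D -> ~ equiv_effective D.
Proof.
move=> irr /equiv_effectiveP[f eff].
have /card_gt0P[v0 _] := card_vert_gt0 G.
pose m := [arg max_(v > v0) f v]%O.
have mP v : f v <= f m by rewrite /m; case: Order.TotalTheory.arg_maxP => // i _; apply.
have [|v] := irr [set v | f v == f m].
  by apply/set0Pn; exists m; rewrite inE.
rewrite inE => /eqP fv; apply/negP; rewrite -leNgt.
have := eff v; rewrite !divisorE subr_ge0; apply: le_trans.
rewrite laplaceE /cut (big_morph Posz PoszD (erefl _)) [leLHS]big_mkcond /=.
apply: ler_sum => u _; rewrite inE fv; have := mP u.
by case: eqP => /= [->|/eqP ne le]; [rewrite subrr mulr0|nia].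
Qed.

Lemma unfireable_extend D : unfireable D ->
  exists F, [/\ divle D F, unfireable F & divdeg F = genus G - 1].
Proof.
move=> irr.
(* [W] is the set burnt so far. On it [F] sums to the number of edges inside [W] minus [#|W|];
   ordered pairs count each edge twice, hence the factor 2. *)
suff /(_ #|vert G| (leqnn _)) [W [F [cardW DF irrF degF]]] : forall n, (n <= #|vert G|)%N ->
    exists W F, [/\ #|W| = n, (forall v, v \in W -> D v <= F v),
      (forall A, A \subset W -> A != set0 -> exists2 v, v \in A &
          F v < (\sum_(u in W :\: A) multiplicity v u)%:Z) &
      2 * \sum_(v in W) F v =
        (\sum_(v in W) \sum_(u in W) multiplicity v u)%:Z - 2 * #|W|%:Z].
  have WT : W = setT.
    by apply/eqP; rewrite eqEcard subsetT cardsT cardW leqnn.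
  exists F; split=> [v|A /(irrF A)|].
  - by apply: DF; rewrite WT inE.
  - rewrite WT subsetT => /(_ isT)[v vA Fv]; exists v => //.
    by move: Fv; rewrite /cut; under eq_bigl => u do rewrite !inE andbT.
  move: degF; rewrite WT cardsT /genus /divdeg.
  have bT (R : Type) (idx : R) (op : R -> R -> R) (h : vert G -> R) :
      \big[op/idx]_(v in [set: vert G]) h v = \big[op/idx]_v h v.
    by apply: eq_bigl => v; rewrite inE.
  rewrite !bT; under [X in X%:Z - _]eq_bigr => v _ do rewrite bT.
  rewrite sum_multiplicity; set x : int := \sum_v F v; set m := #|edge G|.
  by set n := #|vert G|; lia.
elim=> [_|n IHn ltn].
  exists set0, D; split; rewrite ?cards0 //.
    by move=> A; rewrite subset0 => /eqP->; rewrite eqxx.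
  by rewrite !big_set0.
have [W [F [cardW DF irrF degF]]] := IHn (ltnW ltn).
(* Unfireability of the unburnt set yields a vertex with fewer chips than edges to [W]: it burns
   next. *)
have [|w] := irr (~: W).
  by rewrite -card_gt0 cardsCs setCK cardW subn_gt0.
rewrite inE /cut => wW Dw.
have {}Dw : D w < (\sum_(u in W) multiplicity w u)%:Z.
  by move: Dw; under eq_bigl => u do rewrite inE negbK.
(* Orienting edges by burning time, [w] receives its indegree minus one. *)
pose F' : divisor G :=
  [ffun v => if v == w then (\sum_(u in W) multiplicity w u)%:Z - 1 else F v].
have F'W v : v \in W -> F' v = F v.
  by move=> vW; rewrite ffunE; case: eqP => // vw; rewrite -vw vW in wW.
have F'w : F' w = (\sum_(u in W) multiplicity w u)%:Z - 1 by rewrite ffunE eqxx.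
exists (w |: W), F'; split.
- by rewrite cardsU1 wW cardW.
- move=> v; rewrite !inE => /orP[/eqP->|vW]; last by rewrite F'W ?DF.
  by rewrite F'w; lia.
(* If [A] misses [W], it consists of [w] alone; otherwise a witness for [A :&: W] still works, since
   adding [w] to [W] can only add outgoing edges. *)
- move=> A AW A0; have [AW0|AW0] := eqVneq (A :&: W) set0.
    exists w.
      have /set0Pn[v vA] := A0; have := subsetP AW v vA.
      rewrite !inE => /orP[/eqP<- //|vW].
      by have := in_set0 v; rewrite -AW0 inE vA vW.
    have -> : (w |: W) :\: A = W.
      apply/setP => u; rewrite !inE; apply/andP/idP => [[uA]|uW].
        case/orP => [/eqP uw|//]; move: A0 => /set0Pn[v vA].
        have := subsetP AW v vA; rewrite !inE => /orP[/eqP vw|vW].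
          by rewrite uw -vw vA in uA.
        by have := in_set0 v; rewrite -AW0 inE vA vW.
      split; last by rewrite uW orbT.
      by apply/negP => uA; have := in_set0 u; rewrite -AW0 inE uA uW.
    by rewrite F'w; lia.
  have [v] := irrF _ (subsetIr A W) AW0.
  rewrite inE => /andP[vA vW] Fv; exists v => //.
  rewrite F'W //; apply: lt_le_trans Fv _; rewrite lez_nat.
  rewrite big_mkcond [leqRHS]big_mkcond /=; apply: leq_sum => u _.
  by rewrite !inE; case: (u \in A); case: (u \in W); rewrite ?orbT //=.
have -> : (\sum_(v in w |: W) \sum_(u in w |: W) multiplicity v u =
    2 * \sum_(u in W) multiplicity w u
    + \sum_(v in W) \sum_(u in W) multiplicity v u)%N.
  rewrite big_setU1 //= big_setU1 //= multiplicity_diag add0n.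
  under [X in (_ + X)%N]eq_bigr => v _ do rewrite big_setU1 //= multiplicityC.
  by rewrite big_split /= addnA mul2n addnn.
rewrite big_setU1 //= F'w cardsU1 wW (eq_bigr _ F'W) mulrDr degF /=.
by lia.
Qed.

(** * Debt and legal firing *)

Definition debt D : int := \sum_v Num.max 0 (- D v).

(* The chips present are bounded by degree plus initial debt, and a vertex [w]
   adjacent to [x] sends [x] at least [f w] of them: the bound propagates from
   [q] along paths. *)
Lemma legal_firing_bounded D q : mg_connected G ->
  forall v, exists b : int, forall f, (forall u, 0 <= f u) -> f q = 0 ->
    (forall u, Num.min 0 (D u) <= (D - laplace f) u) -> f v <= b.
Proof.
move=> conn v; have /connectP[p] := conn q v.
elim/last_ind: p v => [|p w IHp] v.
  by move=> _ ->; exists 0 => f _ ->.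
rewrite rcons_path last_rcons => /andP[qp adj] ->{v}.
have [b bP] := IHp _ qp erefl; set x := last q p in adj bP.
(* Final chips at [x] are [D x], minus at most [valency x * b], plus at least [f w]; solve for
   [f w]. *)
pose B : int := divdeg D + debt D - D x + (valency x)%:Z * b.
exists B => f f0 fq leg.
have fx := bP f f0 fq leg.
have up : (D - laplace f) x <= divdeg D + debt D.
  have -> : divdeg D = divdeg (D - laplace f).
    by rewrite divdegB divdeg_laplace subr0.
  rewrite /divdeg /debt -big_split /= (bigD1 x) //=.
  rewrite -[leLHS]addr0 lerD //; first by rewrite lerDl le_max lexx.
  have cover (a c : int) : Num.min 0 a <= c -> 0 <= c + Num.max 0 (- a) by lia.
  by apply: sumr_ge0 => u _; apply: cover.
have : f w <= \sum_u (multiplicity x u)%:Z * f u.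
  rewrite (bigD1 w) //= -[leLHS]addr0 lerD //.
    by have := adjacent_multiplicity adj; have := f0 w; nia.
  by apply: sumr_ge0 => u _; rewrite mulr_ge0.
have : laplace f x = (valency x)%:Z * f x - \sum_u (multiplicity x u)%:Z * f u.
  rewrite laplaceE; under eq_bigr => u _ do rewrite mulrBr.
  by rewrite sumrB -mulr_suml -(big_morph Posz PoszD (erefl _)) -valency_sum.
move: up; rewrite !divisorE /B; have := f0 x; nia.
Qed.

Lemma exists_unfireable D : mg_connected G -> ~ equiv_effective D ->
  exists f, unfireable (D - laplace f).
Proof.
move=> conn; have [f0 _ f0min] := @exists_argmin_nat (vert G -> int)
  (fun=> True) (fun f => absz (debt (D - laplace f))) (ex_intro _ (fun=> 0) I).
rewrite -(equiv_effective_laplace _ f0); set C : divisor G := D - laplace f0 => Cne.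
have debt0 E : 0 <= debt E by apply: sumr_ge0 => v _; rewrite le_max lexx.
have Cmin f : debt C <= debt (C - laplace f).
  have := f0min (fun v => f0 v + f v) I; rewrite laplaceD opprD addrA -/C.
  by rewrite -lez_nat !gez0_abs.
suff [f irr] : exists f, unfireable (C - laplace f).
  by exists (fun v => f0 v + f v); rewrite laplaceD opprD addrA.
clearbody C; have [q Cq] : exists q, C q < 0.
  apply: contrapT => nq; apply: Cne; apply/equiv_effectiveP; exists (fun=> 0) => v.
  by rewrite laplace0 subr0 divisor0E leNgt; apply/negP => Cv; apply: nq; exists v.
(* Legal firings: [q] never fires, and no vertex ends deeper in debt than it began. *)
pose P f := [/\ forall u, 0 <= f u, f q = 0 &
  forall u, Num.min 0 (C u) <= (C - laplace f) u].
have [b bP] := boolp.choice (legal_firing_bounded C q conn).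
(* Minimising [m] maximises the total firing: under [P] the difference is nonnegative, so [absz]
   changes nothing. *)
pose m f : nat := absz (\sum_v b v - \sum_v f v)%R.
have [|f [f_ge0 fq leg] fmax] := @exists_argmin_nat _ P m.
  by exists (fun=> 0); split=> // u; rewrite laplace0 subr0 ge_min lexx orbT.
exists f => A A0; apply: contrapT => fire.
have {}fire v : v \in A -> (cut A v)%:Z <= (C - laplace f) v.
  by move=> vA; rewrite leNgt; apply/negP => lt; apply: fire; exists v.
(* Otherwise the debt at [q] has been cleared, contradicting minimality. *)
have qA : q \notin A.
  apply/negP => /fire Cfq; have := Cmin f; apply/negP; rewrite -ltNge.
  have mono (a c : int) :
    Num.min 0 a <= c -> Num.max 0 (- c) <= Num.max 0 (- a) by lia.
  have smono (a c : int) :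
    a < 0 -> 0 <= c -> Num.max 0 (- c) < Num.max 0 (- a) by lia.
  rewrite /debt (bigD1 q) //= [ltRHS](bigD1 q) //= ltr_leD //.
    by apply: smono => //; apply: le_trans Cfq.
  by apply: ler_sum => u _; apply: mono.
(* Firing [A] once more would be legal and increase the total. *)
pose g v := f v + indicator A v.
have Pg : P g.
  split=> [u||u]; rewrite /g.
  - by rewrite addr_ge0.
  - by rewrite fq /indicator (negPf qA).
  rewrite laplaceD opprD addrA divisorBE; have [uA|uA] := boolP (u \in A).
    by rewrite laplace_indicator_in // ge_min subr_ge0 fire.
  by apply: le_trans (leg u) _; rewrite lerDl oppr_ge0 laplace_indicator_notin.
have sumg : \sum_v g v = \sum_v f v + #|A|%:Z.
  rewrite big_split /=; congr (_ + _).
  rewrite -sum1_card (big_morph Posz PoszD (erefl _)) [RHS]big_mkcond.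
  by apply: eq_bigr => v _; rewrite /indicator; case: (v \in A).
have Pb h : P h -> \sum_v h v <= \sum_v b v.
  by move=> [h0 hq hl]; apply: ler_sum => v _; apply: bP.
have := fmax g Pg; have := Pb g Pg; rewrite /m sumg.
by move: A0; rewrite -card_gt0; lia.
Qed.

(** * Extension to degree [genus G - 1], and the rank *)

Lemma not_equiv_effective_extend D : mg_connected G -> ~ equiv_effective D ->
  exists F, [/\ divle D F, ~ equiv_effective F & divdeg F = genus G - 1].
Proof.
move=> conn /(exists_unfireable conn)[f /unfireable_extend[F [DF irr degF]]].
(* Undoing the firing keeps order, degree and class. *)
exists (F + laplace f); split.
- by move=> v; have := DF v; rewrite !divisorE; lia.
- rewrite -(equiv_effective_laplace _ f) addrK.
  exact: unfireable_not_equiv_effective.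
rewrite -degF -[in RHS](addrK (laplace f) F) divdegB divdeg_laplace.
by rewrite subr0.
Qed.

Lemma effective_sub F (n : nat) : effective F -> n%:Z <= divdeg F ->
  exists E, [/\ effective E, divle E F & divdeg E = n%:Z].
Proof.
move=> F0; elim: n => [_|n IHn nF].
  by exists 0; split => //; apply: big1 => v _; rewrite ffunE.
have [|E [E0 EF degE]] := IHn; first by lia.
have [v Ev] : exists v, E v < F v.
  apply: contrapT => nv; have : divdeg F <= divdeg E; last by lia.
  apply: ler_sum => v _; rewrite leNgt; apply/negP => lt; apply: nv.
  by exists v.
pose E' : divisor G := [ffun u => E u + (u == v)%:Z].
have E'E u : E' u = E u + (u == v)%:Z by rewrite ffunE.
exists E'; split=> [u|u|].
- by rewrite divisor0E E'E addr_ge0 //; have := E0 u; rewrite divisor0E.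
- by have := EF u; rewrite E'E; case: eqP => [->|_]; lia.
rewrite /divdeg (eq_bigr _ (fun u _ => E'E u)) big_split /=.
rewrite -/(divdeg E) degE (bigD1 v) //= eqxx big1; first by lia.
by move=> u /negPf->.
Qed.

End Laplacian.

Theorem lemma5p5 (G : multigraph) (G_connected : mg_connected G)
    (D : divisor G) (k : int) (degD : divdeg D = k) (k_le : k <= genus G - 1) :
  exists D' : divisor G,
    [/\ divle D D', divdeg D' = genus G - 1 & rank D = rank D'].
Proof.
rewrite /rank; case: ex_minnP => n /asboolP[E [E0 degE DE]] minn.
have [F [DEF Fne degF]] := not_equiv_effective_extend G_connected DE.
have degFD : divdeg (F - (D - E)) = genus G - 1 - k + n%:Z.
  by rewrite !divdegB degF degD degE; lia.
have [||H [H0 HF degH]] := @effective_sub _ (F - (D - E)) (absz (genus G - 1 - k)%R).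
- by move=> v; have := DEF v; rewrite !divisorE; lia.
- by rewrite degFD; lia.
exists (D + H); split.
- by move=> v; have := H0 v; rewrite !divisorE; lia.
- by rewrite -[H]opprK divdegB degD -sub0r divdegB degH /divdeg big1 => [|v _]; rewrite ?ffunE; lia.
case: ex_minnP => n' /asboolP[E' [E'0 degE' DE']] minn'.
congr (Posz _ - 1); apply/eqP; rewrite eqn_leq minn ?minn' //.
  apply/asboolP; exists E; split=> //; apply: contra_not Fne.
  by apply: equiv_effective_le => v; have := HF v; rewrite !divisorE; lia.
(* As [H] is effective, [D - E'] lies below [D + H - E'], so [E'] obstructs [D] too. *)
apply/asboolP; exists E'; split=> //; apply: contra_not DE'.
by apply: equiv_effective_le => v; have := H0 v; rewrite !divisorE; lia.
Qed.
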